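(* Let $r,s,\ell,k,m$ be positive integers with $r\ge s$, $\ell\ge k$, $r\ge\ell$, $s\ge k$, and $k\ell\le m\le rs$. Let $G=G[U,W]$ be a bipartite graph with parts $U$ and $W$, $|U|=r$, $|W|=s$, and exactly $m$ edges. Suppose that there exists a subset $I\subseteq W$ with $|I|=k$ and $\delta_G(I)\ge \ell$. Then $$N(S_2,G)\le\begin{cases} N\big(S_2,B_1(r,s,m,\ell,k)\big), & \text{if } m\le rk \text{ and } k+\ell\le r,\\ N\big(S_2,B_2(r,s,m,\ell,k)\big), & \text{if } m\le rk \text{ and } k+\ell>r,\\ N\big(S_2,B(r,s,m)\big), & \text{if } m\ge rk.\end{cases}$$
   Context: All graphs are finite and simple. $S_2$ denotes the star with two edges. $N(S_2,G)$ is the number of (not necessarily induced) subgraphs of $G$ isomorphic to $S_2$, i.e. $N(S_2,G)=\sum_{v\in V(G)}\binom{d_G(v)}{2}$, where $d_G(v)$ is the degree of $v$. For $S\subseteq V(G)$, $\delta_G(S)=\min\{d_G(v):v\in S\}$. For a positive integer $t$, $[t]=\{1,\dots,t\}$, $[0]=\emptyset$, and for integers $a\le b$, $[a,b]=\{a,\dots,b\}$, with $[a,b]=\emptyset$ if $a>b$. All of the following bipartite graphs have parts $\{u_1,\dots,u_r\}$ and $\{w_1,\dots,w_s\}$. - $B(r,s,m)$, for $m\le rs$ and $r\ge s$: write $m=rp+q$ with integers $p\ge0$, $0\le q\le r-1$. The edge set is $\{\{u_i,w_j\}:(i,j)\in[r]\times[p]\}\cup\{\{u_i,w_{p+1}\}: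 i\in[q]\}$. - $B_1(r,s,m,\ell,k)$, for $r\ge\ell$, $s\ge k$, $k\ell\le m\le rk$ (used when $r>\ell$): write $m=k\ell+p(r-\ell)+q$ with integers $p\ge0$, $0\le q\le r-\ell-1$. The edge set is the union of $\{\{u_i,w_j\}:(i,j)\in[r]\times[p]\}$, $\{\{u_i,w_{p+1}\}:i\in[\ell+q]\}$ (this second set is omitted if $p=k$, which happens only when $m=rk$), and $\{\{u_i,w_j\}:(i,j)\in[\ell]\times[p+2,k]\}$. - $B_2(r,s,m,\ell,k)$, for $r\ge\ell$, $s\ge k$, $k\ell\le m\le rk$: write $m=k\ell+pk+q$ with integers $p\ge0$, $0\le q\le k-1$. The edge set is $\{\{u_i,w_j\}:(i,j)\in[\ell+p]\times[k]\}\cup\{\{u_{\ell+p+1},w_i\}:i\in[q]\}$. *)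

(* Defs.v *)
From mathcomp Require Import all_boot.

Set Implicit Arguments.
Unset Strict Implicit.
Unset Printing Implicit Defensive.

Record sgraph := SGraph {
  vertex :> finType;
  adj : rel vertex;
  adj_sym : symmetric adj;
  adj_irrefl : irreflexive adj }.

Definition edges (G : sgraph) : {set {set G}} :=
  [set [set p.1; p.2] | p : G * G & adj p.1 p.2].

Definition deg (G : sgraph) (v : G) : nat := #|[set w | adj v w]|.

(* Since [deg v <= #|G|], the default value only matters when [S] is empty. *)
Definition mindeg (G : sgraph) (S : {set G}) : nat :=
  \big[minn/#|G|]_(v in S) deg v.

(* A copy of the two-edge star is a centre together with an unordered pair of
   neighbours of it, and the centre is determined by the copy. *)
Definition num_S2 (G : sgraph) : nat := \sum_(v : G) 'C(deg v, 2).

Definition bipartition (G : sgraph) (U W : {set G}) : Prop :=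
  [/\ U :|: W = [set: G], [disjoint U & W] &
      forall x y, adj x y -> (x \in U) && (y \in W) || (x \in W) && (y \in U)].

Section BipartiteOn.

Variables (r s : nat) (E : nat -> nat -> bool).

(* [inl i] is u_(i+1) and [inr j] is w_(j+1): the relation [E] is on the
   1-based indices. *)
Definition bip_adj (x y : 'I_r + 'I_s) : bool :=
  match x, y with
  | inl i, inr j | inr j, inl i => E i.+1 j.+1
  | _, _ => false
  end.

Fact bip_adj_sym : symmetric bip_adj.
Proof. by case=> [i|j] [i'|j']. Qed.

Fact bip_adj_irrefl : irreflexive bip_adj.
Proof. by case. Qed.

Definition bip_graph : sgraph := SGraph bip_adj_sym bip_adj_irrefl.

End BipartiteOn.

Definition graphB (r s m : nat) : sgraph :=
  let p := m %/ r in
  let q := m %% r in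
  bip_graph r s (fun i j => (j <= p) || (j == p.+1) && (i <= q)).

(* Meaningful for l < r and k * l <= m <= r * k. *)
Definition graphB1 (r s m l k : nat) : sgraph :=
  let p := (m - k * l) %/ (r - l) in
  let q := (m - k * l) %% (r - l) in
  bip_graph r s (fun i j =>
    [|| j <= p,
        [&& p != k, j == p.+1 & i <= l + q] |
        (i <= l) && (p.+2 <= j <= k)]).

(* Meaningful for 0 < k and k * l <= m <= r * k. *)
Definition graphB2 (r s m l k : nat) : sgraph :=
  let p := (m - k * l) %/ k in
  let q := (m - k * l) %% k in
  bip_graph r s (fun i j =>
    (i <= l + p) && (j <= k) || (i == (l + p).+1) && (j <= q)).

(* Main.v *)
(** Let [b] list the degrees in [W] in decreasing order.  A vertex of [U] contributes one star for
    each pair of its neighbours, and two vertices of [W] have at most as many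
    common neighbours as the smaller of their degrees, so the number of stars is
    at most [stair b], with equality when the neighbourhoods in [W] are nested.
    It is the total weight of a Young diagram whose cell in
    row [i] and column [j], counted from 0, weighs [i + j].

    Among the diagrams with [n] cells in a given box, filling lines parallel to
    the longer side one after the other is optimal, by induction on the number of
    columns.  When [k] columns have height at least [l], let [L] be the height of
    the [k]-th column.  The diagram is an [L * k] block, a diagram above it and one
    to its right; moving the right part on top of the block loses nothing, because
    [L >= k] and lengthening the lines by [d] gains at most [d] per cell.  Finally
    [L] may be lowered to [l]. *)

Require Import Defs.
From mathcomp Require Import all_boot zify.

Set Implicit Arguments.
Unset Strict Implicit.
Unset Printing Implicit Defensive.

(** * Filling a box line by line *)

(* The total weight of [n] cells filling successive lines of length [R], where the
   [j]-th cell of the [i]-th line weighs [i + j]. *)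
Definition fill (R n : nat) : nat :=
  n %/ R * 'C(R, 2) + R * 'C(n %/ R, 2) + 'C(n %% R, 2) + n %/ R * (n %% R).

Lemma bin2S n : 'C(n.+1, 2) = 'C(n, 2) + n.
Proof. by rewrite binS bin1. Qed.

Lemma bin2_double n : 2 * 'C(n, 2) + n = n * n.
Proof. by elim: n => // n IH; rewrite bin2S; nia. Qed.

Lemma bin2D m n : 'C(m + n, 2) = 'C(m, 2) + 'C(n, 2) + m * n.
Proof. move: (bin2_double m) (bin2_double n) (bin2_double (m + n)); lia. Qed.

Lemma fill0 R : fill R 0 = 0.
Proof. by rewrite /fill div0n mod0n bin0n !muln0. Qed.

(** Allowing [q = R] lets a full last line count as incomplete, so later decompositions need not be
    normalised. *)
Lemma fillE R p q : 0 < R -> q <= R ->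
  fill R (p * R + q) = p * 'C(R, 2) + R * 'C(p, 2) + 'C(q, 2) + p * q.
Proof.
move=> R_gt0; rewrite leq_eqVlt => /predU1P[->|lt_qR].
  rewrite addnC -mulSn /fill mulnK // modnMl bin0n bin2S; nia.
by rewrite /fill divnMDl // modnMDl divn_small // modn_small // addn0.
Qed.

Lemma fill_small R n : 0 < R -> n <= R -> fill R n = 'C(n, 2).
Proof.
move=> R_gt0 le_nR; have := fillE 0 R_gt0 le_nR.
by rewrite !mul0n bin0n muln0 !add0n addn0. Qed.

Lemma fillDl R n : 0 < R -> fill R (R + n) = 'C(R, 2) + n + fill R n.
Proof.
move=> R_gt0; rewrite (divn_eq n R) addnA -mulSn.
have lt_q := ltn_pmod n R_gt0.
by rewrite !fillE ?(ltnW lt_q) // bin2S; nia.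
Qed.

(** If the incomplete line has at least as many cells as there are full lines, it gives one cell to
    each of them. Otherwise the last full line is broken up to lengthen the others, and its
    remainder joins the incomplete line; the bound on [n] ensures that it has enough cells. *)
Lemma fillS_le R n : 0 < R -> n <= R * R.+1 -> fill R n <= fill R.+1 n.
Proof.
move=> R_gt0; rewrite (divn_eq n R); have := ltn_pmod n R_gt0.
move: (n %/ R) (n %% R) => p q lt_qR le_n.
rewrite fillE ?(ltnW lt_qR) //.
have [le_pq|lt_qp] := leqP p q.
  have [e Dq] : exists e, q = p + e by exists (q - p); lia.
  have -> : p * R + q = p * R.+1 + e by nia.
  rewrite fillE //; last by lia.
  rewrite Dq bin2S !bin2D; move: (bin2_double p); nia.
case: p le_n lt_qp => // p le_n le_qp.
have le_pR : p <= R by nia.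
have [e Re] : exists e, R = p + e by exists (R - p); lia.
have -> : p.+1 * R + q = p * R.+1 + (q + e) by nia.
rewrite fillE //; last by lia.
(* If [e = 0], then [p = R] and the bound on [n] forces [q = 0]. *)
have q_e : q <= q * e by case: e Re => [|e] Re; nia.
rewrite Re !bin2S !bin2D; nia.
Qed.

Lemma fill_le R R' n : 0 < R -> R <= R' -> n <= R * R.+1 -> fill R n <= fill R' n.
Proof.
move=> R_gt0 /subnKC <- le_n; elim: (R' - R) => [|d IH]; first by rewrite addn0.
rewrite addnS (leq_trans IH) // fillS_le ?addn_gt0 ?R_gt0 //.
by rewrite (leq_trans le_n) // leq_mul ?ltnS ?leq_addr.
Qed.

Lemma fill_leS R n : 0 < R -> fill R n <= fill R n.+1.
Proof.
move=> R_gt0; rewrite (divn_eq n R) -addnS; have lt_q := ltn_pmod n R_gt0.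
rewrite !fillE ?(ltnW lt_q) // bin2S; nia.
Qed.

(** Peeling one line off each side leaves [x] cells against [x.+1], a difference that monotonicity
    in [n] absorbs. *)
Lemma fillS_le_add R n : 0 < R -> fill R.+1 n <= n + fill R n.
Proof.
move=> R_gt0; have [N] := ubnP n; elim: N n => // N IH n /ltnSE le_nN.
have [le_nR|lt_Rn] := leqP n R.
  by rewrite !fill_small // ?leqW // leq_addl.
have [x Dn] : exists x, n = R.+1 + x by exists (n - R.+1); lia.
rewrite Dn fillDl // addSnnS fillDl // bin2S.
have := fill_leS x R_gt0; have : x < N by lia.
by move/IH; lia.
Qed.

Lemma fillD_le_add R d n : 0 < R -> fill (R + d) n <= d * n + fill R n.
Proof.
move=> R_gt0; elim: d => [|d IH]; first by rewrite addn0.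
rewrite addnS (leq_trans (fillS_le_add _ _)) ?addn_gt0 ?R_gt0 //; lia.
Qed.

(** Full lines are peeled off the larger pile. Once both piles are shorter than a line, the smaller
    one first completes the line begun by the larger; a surplus [x] starts the next line, and
    [x <= n <= m] pays for cutting the smaller pile. *)
Lemma fill_superadd R m n : 0 < R -> fill R m + fill R n <= fill R (m + n).
Proof.
move=> R_gt0; have [N] := ubnP (m + n).
elim: N m n => // N IH m n /ltnSE le_N.
wlog le_nm : m n le_N / n <= m.
  move=> H; case/orP: (leq_total n m) => [|le_mn]; first exact: H.
  by rewrite addnC [m + n]addnC H // addnC.
have [lt_mR|le_Rm] := ltnP m R; last first.
  have [x Dm] : exists x, m = R + x by exists (m - R); lia.
  have := IH x n; rewrite Dm -addnA !fillDl //; lia.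
have lt_nR := leq_ltn_trans le_nm lt_mR.
rewrite (fill_small R_gt0 (ltnW lt_mR)) (fill_small R_gt0 (ltnW lt_nR)).
have [le_R|/ltnW le_R] := leqP (m + n) R.
  by rewrite fill_small // bin2D leq_addr.
have [x Dx] : exists x, m + n = R + x by exists (m + n - R); lia.
rewrite Dx fillDl // fill_small //; last by lia.
have [e De] : exists e, R = m + e by exists (R - m); lia.
have -> : n = e + x by lia.
rewrite De !bin2D; nia.
Qed.

(* On the left, a first column of height [h] next to rows of length [S]: the full
   rows become rows of length [S + 1], and only a hook has to be straightened. *)
Lemma fill_add_short S h n : h <= S -> n <= h * S ->
  'C(h, 2) + n + fill S n <= fill S.+1 (n + h).
Proof.
case: (posnP S) => [->|S_gt0 le_hS].
  by rewrite leqn0 => /eqP->; rewrite muln0 leqn0 => /eqP->; rewrite !fill0.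
rewrite (divn_eq n S); have := ltn_pmod n S_gt0.
move: (n %/ S) (n %% S) => p q lt_qS le_n.
have le_ph : p <= h by nia.
have [e Dh] : exists e, h = p + e by exists (h - p); lia.
rewrite fillE ?(ltnW lt_qS) //.
have -> : p * S + q + h = p * S.+1 + (q + e) by nia.
have q_e : q <= q * e by case: e Dh => [|e] Dh; nia.
have [le_S|lt_S] := leqP (q + e) S.+1.
  rewrite fillE // Dh bin2S !bin2D; nia.
have [x Dx] : exists x, q + e = S.+1 + x by exists (q + e - S.+1); lia.
have -> : p * S.+1 + (q + e) = p.+1 * S.+1 + x by nia.
rewrite fillE //; last by lia.
have [f Df] : exists f, S = q + f by exists (S - q); lia.
have De : e = f.+1 + x by lia.
rewrite Dh De Df !(bin2S, bin2D); nia.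
Qed.

(** Induction step of the box bound: a column of height [h] is put in front of [n] cells in [s]
    columns of height at most [h]. If [s <= h], the column is itself the first line of length [h];
    otherwise [fill_add_short] applies. Then [fill_le] passes to longer lines. *)
Lemma fill_add_line r s h n : h <= r -> n <= h * s ->
  'C(h, 2) + n + fill (maxn h s) n <= fill (maxn r s.+1) (n + h).
Proof.
move=> le_hr le_n; case: (posnP h) => [h0|h_gt0].
  by move: le_n; rewrite h0 leqn0 => /eqP->; rewrite !fill0.
have [le_sh|lt_hs] := leqP s h.
  rewrite -fillDl // addnC fill_le //; nia.
apply: leq_trans (fill_add_short (ltnW lt_hs) le_n) _.
by rewrite fill_le //; nia.
Qed.

(** * Weights of Young diagrams *)

(** The first column weighs [0 + ... + (h - 1)]; the later columns stand one place further right,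
    which adds 1 for each of their cells. *)
Fixpoint stair (b : seq nat) : nat :=
  if b is h :: b' then 'C(h, 2) + sumn b' + stair b' else 0.

Lemma sumn_le_path r b : path geq r b -> sumn b <= r * size b.
Proof.
elim: b r => //= h b IH r /andP[le_hr /IH]; nia.
Qed.

Lemma stair_le_fill r b : path geq r b -> stair b <= fill (maxn r (size b)) (sumn b).
Proof.
elim: b r => [|h b IH] r /=; first by rewrite fill0.
case/andP=> le_hr hb; rewrite [h + _]addnC.
apply: leq_trans (fill_add_line le_hr (sumn_le_path hb)).
by rewrite leq_add2l IH.
Qed.

Lemma stair_cat b c :
  stair (b ++ c) = stair b + size b * sumn c + stair c.
Proof. by elim: b => //= h b ->; rewrite sumn_cat; lia. Qed.

Lemma sumn_map_addn d b : sumn (map (addn d) b) = d * size b + sumn b.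
Proof. by elim: b => [|h b IH] /=; lia. Qed.

(** The first two terms weigh the rectangle inserted under the diagram, whose cells each rise by
    [d]. *)
Lemma stair_map_addn d b : stair (map (addn d) b) =
  d * 'C(size b, 2) + 'C(d, 2) * size b + d * sumn b + stair b.
Proof.
elim: b => [|h b IH] /=; first by rewrite !muln0.
rewrite IH sumn_map_addn bin2D bin2S; nia.
Qed.

(** * Diagrams with [k] tall columns *)

(* The weight of [l] rows of length [k] and of [m - k * l] further cells above them,
   which fill the [(r - l) * k] box along its longer side. *)
Definition block_fill (r k l m : nat) : nat :=
  l * 'C(k, 2) + 'C(l, 2) * k + l * (m - k * l) + fill (maxn (r - l) k) (m - k * l).

(** Lowering the block by one row releases [k] cells to the part above. As the weight [i + j] is
    symmetric, this row acts as the new first column in [fill_add_line]. *)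
Lemma block_fill_anti r k l L m : l <= L <= r -> k * L <= m <= r * k ->
  block_fill r k L m <= block_fill r k l m.
Proof.
case/andP=> le_lL le_Lr; case/andP=> le_m le_mr.
rewrite -(subnKC le_lL) in le_Lr le_m *.
elim: (L - l) le_Lr le_m => [|d IH] le_Lr le_m; first by rewrite addn0.
apply: leq_trans (IH _ _); try nia.
move: (l + d) (addnS l d) => x Dx; rewrite Dx in le_Lr le_m *.
rewrite /block_fill.
have [n Dn] : exists n, m = k * x.+1 + n by exists (m - k * x.+1); lia.
rewrite Dn addKn.
have -> : k * x.+1 + n - k * x = n + k by nia.
have := @fill_add_line k (r - x.+1) k n (leqnn k).
have -> : (r - x.+1).+1 = r - x by lia.
rewrite bin2S [maxn k (_ - x.+1)]maxnC [maxn k (_ - x)]maxnC => /(_ _).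
have H : n <= k * (r - x.+1) by nia.
move/(_ H); nia.
Qed.

Lemma last_le_path r b : path geq r b -> all (leq (last r b)) (r :: b).
Proof.
elim: b r => [|h b IH] r /=; first by rewrite leqnn.
by case/andP=> le_hr /IH/= /andP[le_h ->]; rewrite le_h (leq_trans le_h).
Qed.

Lemma stair_le_block r s k l b : s <= r -> 0 < k -> k <= l -> k <= s ->
  path geq r b -> size b = s -> l <= nth 0 b k.-1 -> sumn b <= r * k ->
  stair b <= block_fill r k l (sumn b).
Proof.
move=> le_sr k_gt0 le_kl le_ks rb sb; set L := nth 0 b k.-1 => lb le_m.
have st : size (take k b) = k by rewrite size_takel // sb.
have Dlast : last r (take k b) = L.
  rewrite -nth_last st nth_take ?prednK // (set_nth_default 0) //.
  by rewrite sb prednK.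
move: rb; rewrite -{1}(cat_take_drop k b) cat_path Dlast => /andP[rt Lnu].
have /andP[le_Lr tL] : all (leq L) (r :: take k b).
  by rewrite -Dlast; apply: last_le_path.
set nu := drop k b in Lnu; set mu := [seq x - L | x <- take k b].
have smu : size mu = k by rewrite size_map.
have Dt : take k b = map (addn L) mu.
  rewrite -map_comp -[LHS]map_id; apply/eq_in_map => x /(allP tL) le_Lx /=.
  by rewrite subnKC.
have rmu : path geq (r - L) mu.
  by apply: homo_path rt => x y; apply: leq_sub2r.
have snu : size nu = s - k by rewrite size_drop sb.
have Db : b = map (addn L) mu ++ nu by rewrite -Dt cat_take_drop.
have Dm : sumn b = k * L + (sumn mu + sumn nu).
  by rewrite Db sumn_cat sumn_map_addn smu; lia.
rewrite (leq_trans _ (@block_fill_anti r k l L (sumn b) _ _)) //; try nia.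
rewrite /block_fill Dm addKn Db stair_cat stair_map_addn size_map smu.
have := stair_le_fill rmu; have := stair_le_fill Lnu; rewrite smu snu => le_nu le_mu.
(* [E] is the line length above the block. A cell of [nu] is offset by [k] on the right but by [L]
   on top, and the gain [L - k] pays for lengthening the lines by [L - k]. *)
set E := maxn (r - L) k in le_mu *.
have E_gt0 : 0 < E by rewrite leq_max k_gt0 orbT.
have := fill_superadd (sumn mu) (sumn nu) E_gt0.
have := fillD_le_add (L - k) (sumn nu) E_gt0.
(* [E + (L - k)] is at least [L] since [k <= E], and at least [s - k] since [r - L <= E] and
   [s <= r]. *)
have : fill (maxn L (s - k)) (sumn nu) <= fill (E + (L - k)) (sumn nu).
  apply: fill_le; [lia | lia |].
  by have := sumn_le_path Lnu; rewrite snu; nia.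
have : k * sumn nu + (L - k) * sumn nu = L * sumn nu.
  by rewrite -mulnDl subnKC // (leq_trans le_kl).
lia.
Qed.

(** * Star counts of the extremal graphs *)

Lemma sum_nat_const_on a b (F : nat -> nat) x :
  (forall i, a <= i < b -> F i = x) -> \sum_(a <= i < b) F i = (b - a) * x.
Proof. by move=> Fx; rewrite (eq_big_nat _ _ Fx) sum_nat_const_nat. Qed.

(** Four plateaus, possibly empty, cover the degree sequences of all three extremal graphs. *)
Lemma sum_nat_steps n a b c (F : nat -> nat) x y z t : a <= b -> b <= c -> c <= n ->
    (forall i, i < a -> F i = x) -> (forall i, a <= i < b -> F i = y) ->
    (forall i, b <= i < c -> F i = z) -> (forall i, c <= i < n -> F i = t) ->
  \sum_(0 <= i < n) F i = a * x + (b - a) * y + (c - b) * z + (n - c) * t.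
Proof.
move=> le_ab le_bc le_cn Fx Fy Fz Ft.
rewrite (@big_cat_nat _ _ _ c) // (@big_cat_nat _ _ _ b 0 c) //=.
rewrite (@big_cat_nat _ _ _ a 0 b) //= (sum_nat_const_on Fy) (sum_nat_const_on Fz).
by rewrite (sum_nat_const_on Ft) (@sum_nat_const_on 0 a _ x) ?subn0.
Qed.

Lemma card_ord_ltn n a : a <= n -> #|[set i : 'I_n | i < a]| = a.
Proof.
by move=> le_an; rewrite -sum1dep_card (big_ord_narrow le_an) sum1_card card_ord.
Qed.

(** Every neighbourhood is an initial segment of the other part, so [f] and [g] are the degrees.
    They are indexed from 0, whereas [E] is indexed from 1. *)
Lemma num_S2_bip r s E (f g : nat -> nat) :
    (forall i, i < r -> f i <= s) -> (forall j, j < s -> g j <= r) ->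
    (forall i j, i < r -> j < s -> E i.+1 j.+1 = (j < f i)) ->
    (forall i j, i < r -> j < s -> E i.+1 j.+1 = (i < g j)) ->
  num_S2 (bip_graph r s E) =
    \sum_(0 <= i < r) 'C(f i, 2) + \sum_(0 <= j < s) 'C(g j, 2).
Proof.
move=> le_f le_g Ef Eg; rewrite /num_S2 big_sumType /= !big_mkord.
congr (_ + _); apply: eq_bigr => i _; congr 'C(_, 2).
  rewrite -(card_ord_ltn (le_f i (ltn_ord i))) -(card_imset _ (@inr_inj 'I_r 'I_s)).
  apply: eq_card => -[j|j]; rewrite !inE /=.
    by apply/esym/imsetP=> -[].
  by rewrite (mem_imset _ _ (@inr_inj 'I_r 'I_s)) inE Ef.
rewrite -(card_ord_ltn (le_g i (ltn_ord i))) -(card_imset _ (@inl_inj 'I_r 'I_s)).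
apply: eq_card => -[j|j]; rewrite !inE /=.
  by rewrite (mem_imset _ _ (@inl_inj 'I_r 'I_s)) inE Eg.
by apply/esym/imsetP=> -[].
Qed.

Lemma num_S2_B r s m : 0 < r -> m <= r * s -> num_S2 (graphB r s m) = fill r m.
Proof.
move=> r_gt0 le_m; rewrite /graphB /fill; have := ltn_pmod m r_gt0.
move: (divn_eq m r); move: (m %/ r) (m %% r) => p q Dm lt_qr.
have le_ps : p <= s by nia.
(* When all [s] columns are full there is no column [p.+1]; below, [minn p.+1 s] then makes its
   plateau empty. *)
have q0 : p = s -> q = 0 by move=> ps; nia.
pose f i := if i < q then p.+1 else p.
pose g j := if j < p then r else if j == p then q else 0.
rewrite (@num_S2_bip _ _ _ f g) /f /g.
- rewrite (@sum_nat_steps r q r r _ 'C(p.+1, 2) 'C(p, 2) 0 0); try lia.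
  + rewrite (@sum_nat_steps s p (minn p.+1 s) s _ 'C(r, 2) 'C(q, 2) 0 0); try lia.
    * case: (eqVneq p s) => [ps|]; first by rewrite (q0 ps) bin0n; nia.
      move=> ne_ps; rewrite bin2S; have -> : minn p.+1 s = p.+1 by lia.
      have [e De] : exists e, r = q + e by exists (r - q); lia.
      rewrite De addKn subSnn !muln0 !addn0 !bin2D; nia.
    * by move=> j ->.
    * by move=> j hj; rewrite (_ : j = p) ?ltnn ?eqxx //; lia.
    * by move=> j hj; case: ltnP => [|_]; [lia | case: eqP => //; lia].
  + by move=> i ->.
  + by move=> i /andP[/leq_gtF->].
- by move=> i lt_ir; case: ltnP => // ?; lia.
- by move=> j lt_js; case: ltnP => // ?; case: eqP; lia.
- by move=> i j lt_ir lt_js; case: (ltnP i q); lia.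
by move=> i j lt_ir lt_js; case: (ltnP j p) => ?; [| case: (eqVneq j p) => ?]; lia.
Qed.

(** As [k <= r - l], the lines above the block have length [r - l], and each raises one vertex of
    [W] from degree [l] to [r]. *)
Lemma num_S2_B1 r s m l k : l < r -> k <= r - l -> k <= s -> k * l <= m <= r * k ->
  num_S2 (graphB1 r s m l k) = block_fill r k l m.
Proof.
move=> lt_lr le_k le_ks /andP[le_m le_mr].
rewrite /graphB1 /block_fill (maxn_idPl le_k) /fill.
have rl_gt0 : 0 < r - l by rewrite subn_gt0.
have [n Dm] : exists n, m = k * l + n by exists (m - k * l); lia.
rewrite Dm addKn; have : n <= (r - l) * k by nia.
have := ltn_pmod n rl_gt0; move: (divn_eq n (r - l)).
move: (n %/ (r - l)) (n %% (r - l)) => p q Dn lt_q le_n.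
have le_pk : p <= k by nia.
have q0 : p = k -> q = 0 by move=> pk; nia.
pose f i := if i < l then k else if i < l + q then p.+1 else p.
pose g j := if j < p then r else if j < k then if j == p then l + q else l else 0.
rewrite (@num_S2_bip _ _ _ f g) /f /g.
- rewrite (@sum_nat_steps r l (l + q) r _ 'C(k, 2) 'C(p.+1, 2) 'C(p, 2) 0); try lia.
  + rewrite (@sum_nat_steps s p (minn p.+1 k) k _ 'C(r, 2) 'C(l + q, 2) 'C(l, 2) 0); try lia.
    * have [e De] : exists e, r = l + q + e by exists (r - (l + q)); lia.
      have Drl : r - l = q + e by lia.
      rewrite Dn Drl De !addKn !muln0 !addn0.
      case: (eqVneq p k) => [pk|ne_pk].
        have -> : minn p.+1 k = k by lia.
        rewrite (q0 pk) pk subnn !addn0 !add0n bin2D.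
        nia.
      have [d Dd] : exists d, k = p.+1 + d by exists (k - p.+1); lia.
      have -> : minn p.+1 k = p.+1 by lia.
      rewrite Dd subSnn addKn !(bin2S, bin2D).
      nia.
    * by move=> j ->.
    * move=> j hj; rewrite (_ : j = p) ?ltnn ?eqxx; last by lia.
      by case: ltnP => //; lia.
    * move=> j hj; case: ltnP => [|_]; first by lia.
      by case: ltnP => [_|]; [case: eqP => //; lia | lia].
    * by move=> j hj; case: ltnP => [|_]; [lia | case: ltnP => //; lia].
  + by move=> i ->.
  + by move=> i /andP[/leq_gtF-> ->].
  + by move=> i hi; case: ltnP => [|_]; [lia | case: ltnP => //; lia].
- by move=> i lt_ir; case: ltnP => // ?; case: ltnP => ?; lia.
- by move=> j lt_js; case: ltnP => // ?; case: ltnP => // ?; case: eqP; lia.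
- by move=> i j lt_ir lt_js; case: (ltnP i l) => ?; [|case: (ltnP i (l + q)) => ?]; lia.
move=> i j lt_ir lt_js; case: (ltnP j p) => ?; first by lia.
by case: (ltnP j k) => ?; [case: (eqVneq j p) => ?|]; lia.
Qed.

(** As [r - l <= k], the lines above the block have length [k], and each is a further vertex of [U]
    joined to the first [k] vertices of [W]. *)
Lemma num_S2_B2 r s m l k : 0 < k -> r - l <= k -> l <= r -> k <= s ->
  k * l <= m <= r * k -> num_S2 (graphB2 r s m l k) = block_fill r k l m.
Proof.
move=> k_gt0 le_rk le_lr le_ks /andP[le_m le_mr].
rewrite /graphB2 /block_fill (maxn_idPr le_rk) /fill.
have [n Dm] : exists n, m = k * l + n by exists (m - k * l); lia.
rewrite Dm addKn; have : n <= (r - l) * k by nia.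
have := ltn_pmod n k_gt0; move: (divn_eq n k).
move: (n %/ k) (n %% k) => p q Dn lt_q le_n.
have le_p : l + p <= r by nia.
have q0 : l + p = r -> q = 0 by move=> pk; nia.
pose f i := if i < l + p then k else if i == l + p then q else 0.
pose g j := if j < q then (l + p).+1 else if j < k then l + p else 0.
rewrite (@num_S2_bip _ _ _ f g) /f /g.
- rewrite (@sum_nat_steps r (l + p) (minn (l + p).+1 r) r _ 'C(k, 2) 'C(q, 2) 0 0); try lia.
  + rewrite (@sum_nat_steps s q k s _ 'C((l + p).+1, 2) 'C(l + p, 2) 0 0); try lia.
    * have [e De] : exists e, k = q + e by exists (k - q); lia.
      rewrite Dn De addKn !muln0 !addn0.
      case: (eqVneq (l + p) r) => [pr|ne_pr].
        rewrite (q0 pr) bin0n !(bin2S, bin2D).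
        nia.
      have -> : minn (l + p).+1 r = (l + p).+1 by lia.
      rewrite !(bin2S, bin2D).
      nia.
    * by move=> j ->.
    * by move=> j /andP[/leq_gtF-> ->].
    * by move=> j hj; case: ltnP => [|_]; [lia | case: ltnP => //; lia].
  + by move=> i ->.
  + by move=> i hi; rewrite (_ : i = l + p) ?ltnn ?eqxx //; lia.
  + by move=> i hi; case: ltnP => [|_]; [lia | case: eqP => //; lia].
- by move=> i lt_ir; case: ltnP => // ?; case: eqP => ?; lia.
- by move=> j lt_js; case: ltnP => // ?; [|case: ltnP => // ?]; lia.
- by move=> i j lt_ir lt_js; case: (ltnP i (l + p)) => ?; [|case: (eqVneq i (l + p)) => ?]; lia.
by move=> i j lt_ir lt_js; case: (ltnP j q) => ?; [|case: (ltnP j k) => ?]; lia.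
Qed.

(** * From the graph to its degree sequence *)

(** At each neighbour [u] in [U], a new vertex [h] forms one pair with every vertex of [ws] adjacent
    to [u]. Summed over [u], this is at most the degree sum of [ws]. *)
Lemma sum_count_le (G : sgraph) (U : {set G}) (ws : seq G) :
  \sum_(u in U) 'C(count (adj u) ws, 2) + \sum_(w <- ws) 'C(deg w, 2) <=
    stair (map (@deg G) ws).
Proof.
elim: ws => [|h ws IH] /=; first by rewrite big_nil addn0 big1.
rewrite big_cons addnCA -addnA leq_add2l.
apply: leq_trans (leq_add (leqnn _) IH); rewrite addnA leq_add2r.
have -> : sumn (map (@deg G) ws) = \sum_(u : G) count (adj u) ws.
  elim: ws {IH} => [|w ws IHws] /=; first by rewrite big1.
  rewrite big_split IHws /deg -sum1dep_card big_mkcond; congr (_ + _).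
  by apply: eq_bigr => u _; rewrite adj_sym; case: adj.
apply: leq_trans (_ : \sum_(u in U) count (adj u) ws +
  \sum_(u in U) 'C(count (adj u) ws, 2) <= _); last first.
  by rewrite leq_add2r [leqRHS](bigID [in U]) leq_addr.
rewrite -big_split leq_sum // => u _ /=; case: adj; last by rewrite leq_addl.
by rewrite add1n bin2S addnC.
Qed.

Lemma num_S2_le_stair (G : sgraph) (U W : {set G}) (ws : seq G) :
  bipartition U W -> perm_eq ws (enum W) -> num_S2 G <= stair (map (@deg G) ws).
Proof.
case=> UW dUW adjUW ws_W; apply: leq_trans (sum_count_le U ws).
rewrite (perm_big _ ws_W) big_enum /num_S2 /=.
have -> : \sum_(v : G) 'C(deg v, 2) = \sum_(v in [predU U & W]) 'C(deg v, 2).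
  by apply: eq_bigl => v; have := in_setT v; rewrite -UW !inE => ->.
rewrite bigU //= leq_add2r leq_sum // => u uU.
suff -> : deg u = count (adj u) ws by [].
rewrite (permP ws_W) -size_filter -(card_uniqP (filter_uniq _ (enum_uniq _))).
apply: eq_card => w; rewrite !inE mem_filter mem_enum; apply/idP/andP=> [uw|[] //].
split=> //; case/orP: (adjUW _ _ uw) => /andP[] // uW.
by rewrite (disjointFr dUW uU) in uW.
Qed.

(** Each edge has exactly one end in [W]; listing that end first turns edges into ordered pairs
    bijectively. *)
Lemma card_edges_bip (G : sgraph) (U W : {set G}) :
  bipartition U W -> #|edges G| = \sum_(w in W) deg w.
Proof.
case=> UW dUW adjUW.
have nUW x : x \in U -> x \in W -> False by move=> xU; rewrite (disjointFr dUW xU).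
have -> : edges G =
    [set [set p.1; p.2] | p in [set p : G * G | (p.1 \in W) && adj p.1 p.2]].
  apply/setP=> A; apply/imsetP/imsetP => -[[x y]]; rewrite !inE /= => xy ->.
    case/orP: (adjUW _ _ xy) => /andP[xU yW]; last by exists (x, y); rewrite ?inE ?xU.
    by exists (y, x); rewrite ?inE /= ?yW 1?adj_sym // setUC.
  by case/andP: xy => _ xy; exists (x, y); rewrite ?inE.
rewrite card_in_imset.
  rewrite -sum1_card; under eq_bigl do rewrite inE.
  rewrite -(pair_big_dep [in W] (fun x y => adj x y) (fun _ _ => 1)) /=.
  by apply: eq_bigr => w _; rewrite sum1dep_card.
have adjW x y : x \in W -> adj x y -> y \in U.
  by move=> xW /adjUW/orP[] /andP[] // /nUW/(_ xW).
move=> [x y] [x' y']; rewrite !inE /= => /andP[xW xy] /andP[x'W x'y'] eqA.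
have := set21 x y; rewrite eqA !inE => /orP[/eqP xx'|/eqP Dx]; last first.
  by case: (@nUW x) => //; rewrite Dx (adjW _ _ x'W).
have := set22 x y; rewrite eqA !inE => /orP[/eqP Dy|/eqP ->]; last by rewrite xx'.
by case: (@nUW y); [exact: adjW xy | rewrite Dy].
Qed.

(** In a decreasing list the entries that are at least [l] form a prefix; index [k.-1] is the [k]-th
    entry. *)
Lemma nth_ge_count l k r b : 0 < k -> path geq r b -> k <= count (leq l) b ->
  l <= nth 0 b k.-1.
Proof.
case: k => // k _ /=; elim: b r k => //= h b IH r k /andP[_ hb].
case: k => [|k] /=; last first.
  by move=> le_k; apply: (IH h) => //; case: (l <= h) le_k; lia.
case: (leqP l h) => //= lt_hl; have : all (geq h) b.
  by apply: order_path_min hb => ? ? ? /= ? ?; lia.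
move=> /allP hb'; rewrite -has_count => /hasP[x /hb' /= ? ?]; lia.
Qed.

Lemma bigmin_le (T : finType) (A : {set T}) (F : T -> nat) n v :
  v \in A -> \big[minn/n]_(x in A) F x <= F v.
Proof.
move=> vA; have := mem_index_enum v; elim: (index_enum T) => //= x e IH.
rewrite inE big_cons => /predU1P[<-|/IH le_v]; first by rewrite vA geq_minl.
by case: ifP => // _; rewrite geq_min le_v orbT.
Qed.

Unset Implicit Arguments.

Theorem theorem1p8 (r s l k m : nat) (G : sgraph) (U W I : {set G})
    (hr : 0 < r) (hs : 0 < s) (hl : 0 < l) (hk : 0 < k) (hm : 0 < m)
    (hsr : s <= r) (hkl : k <= l) (hlr : l <= r) (hks : k <= s)
    (hklm : k * l <= m) (hmrs : m <= r * s)
    (hUW : bipartition U W) (hU : #|U| = r) (hW : #|W| = s)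
    (hE : #|edges G| = m)
    (hIW : I \subset W) (hI : #|I| = k) (hdeg : l <= mindeg I) :
  [/\ m <= r * k -> k + l <= r -> num_S2 G <= num_S2 (graphB1 r s m l k),
      m <= r * k -> r < k + l -> num_S2 G <= num_S2 (graphB2 r s m l k) &
      r * k <= m -> num_S2 G <= num_S2 (graphB r s m)].
Proof.
pose ws := sort (fun x y : G => deg y <= deg x) (enum W).
have ws_W : perm_eq ws (enum W) by rewrite perm_sort.
set b := map (@deg G) ws.
have b_sorted : sorted geq b.
  by rewrite sorted_map sort_sorted // => x y; apply: leq_total.
have sz_b : size b = s by rewrite size_map (perm_size ws_W) -cardE.
have deg_le w : w \in W -> deg w <= r.
  case: hUW => UW dUW adjUW wW; rewrite -hU subset_leq_card //.
  apply/subsetP=> v; rewrite inE => /adjUW/orP[] /andP[] // wU.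
  by rewrite (disjointFr dUW wU) in wW.
have b_path : path geq r b.
  have: all (geq r) b.
    by apply/allP=> x /mapP[w + ->]; rewrite (perm_mem ws_W) mem_enum => /deg_le.
  by move: b_sorted; case: (b) => //= h c -> /andP[-> _].
have sum_b : sumn b = m.
  by rewrite sumnE big_map (perm_big _ ws_W) big_enum -hE (card_edges_bip hUW).
(* [I] supplies [k] distinct vertices of [W] of degree at least [l]. *)
have b_k : l <= nth 0 b k.-1.
  apply: nth_ge_count b_path _ => //.
  rewrite count_map (permP ws_W) -size_filter -hI cardE.
  apply: uniq_leq_size (enum_uniq _) _ => v; rewrite mem_enum mem_filter mem_enum => vI.
  by rewrite (subsetP hIW) //= andbT (leq_trans hdeg) // bigmin_le.
have le_stair := num_S2_le_stair hUW ws_W.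
have le_block : m <= r * k -> num_S2 G <= block_fill r k l m.
  move=> le_m; apply: leq_trans le_stair _; rewrite -sum_b.
  by apply: (stair_le_block hsr) => //; rewrite sum_b.
split=> [le_m le_r|le_m lt_r|_].
- by rewrite num_S2_B1 ?hklm ?le_block //; lia.
- by rewrite num_S2_B2 ?hklm ?le_block //; lia.
rewrite num_S2_B // (leq_trans le_stair) // -sum_b.
(* The longer side of the [r] by [s] box is [r], the line length in [graphB]. *)
by rewrite (leq_trans (stair_le_fill b_path)) // sz_b (maxn_idPl hsr).
Qed.
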